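(* Let $(\Omega,\mu)$ be a probability space and $T:\Omega\to\Omega$ an ergodic measure-preserving map. Let $a:\mathbb{N}\times\Omega\to\mathbb{R}$ be a measurable function with $a(0,\omega)\equiv 0$ such that $a(n+m,\omega)\leq a(n,\omega)+a(m,T^n\omega)$ for all integers $n,m>0$ and a.e. $\omega$, and such that $\omega\mapsto a(1,\omega)$ is integrable. Let $A=\inf_n \frac{1}{n}\int_\Omega a(n,\omega)\,d\mu$ and assume $A$ is finite. Then for almost every $\omega$ there are integers $n_i=n_i(\omega)\to\infty$ and positive real numbers $\delta_\ell=\delta_\ell(\omega)\to 0$ such that for every $i$ and every $\ell\leq n_i$, $$\left|a(n_i,\omega)-a(n_i-\ell,T^\ell\omega)-A\ell\right|\leq \ell\,\delta_\ell(\omega).$$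
   Context: A function $a$ as in the claim is called an integrable subadditive cocycle; $A$ is its asymptotic average. *)

(* Defs.v *)
From HB Require Import structures.
From mathcomp Require Import all_boot all_order all_algebra.
From mathcomp Require Import all_classical all_reals all_analysis.
Set Implicit Arguments. Unset Strict Implicit. Unset Printing Implicit Defensive.
Import Order.TTheory GRing.Theory Num.Theory.
Import numFieldNormedType.Exports.
Local Open Scope classical_set_scope.
Local Open Scope ring_scope.

Definition measure_preserving d (T : measurableType d) (R : realType)
    (P : probability T R) (f : T -> T) : Prop :=
  measurable_fun setT f /\
  forall A : set T, measurable A -> P (f @^-1` A) = P A.

Definition ergodic d (T : measurableType d) (R : realType)
    (P : probability T R) (f : T -> T) : Prop :=
  measure_preserving P f /\
  forall A : set T, measurable A -> f @^-1` A = A ->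
    P A = 0%E \/ P A = 1%E.

Definition asymptotic_average d (T : measurableType d) (R : realType)
    (P : probability T R) (a : nat -> T -> R) : \bar R :=
  ereal_inf [set (((n%:R)^-1)%:E * \int[P]_w (a n w)%:E)%E | n in [set n : nat | (0 < n)%N]].

(* Main.v *)
(* Subtracting [n * A] we may assume A = 0. The upper bound follows from
   a(n, w) - a(n - l, T^l w) <= a(l, w) and limsup a(l, w) / l <= 0 (Birkhoff).
   For the lower bound, call n bad for w at slope c and scale k when
   a(n, w) + c l < a(n - l, T^l w) for some l in [k, n]. The numbers
   a(n, w), a(n - l, T^l w), ... all measure pieces ending at the same point
   T^n w, so being bad is a failure to set a record, and a potential argument
   bounds the sum over n < N of P(n is bad). With steps of length s the bound is
   N int a(s)^+ / (s c) up to a constant, and int a(s)^+ / s tends to 0. Hence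
   for every c, eta some scale k gives sum_(n < N) P(n is bad) <= eta N for all N;
   letting c tend to 0 along growing scales produces a sequence delta_l -> 0 for
   which the Cesaro means of P(n is bad) stay below eta, so that outside a set
   of measure O(eta) infinitely many n are good. *)

Require Import Defs.
From HB Require Import structures.
From mathcomp Require Import all_boot all_order all_algebra.
From mathcomp Require Import all_classical all_reals all_analysis.
From mathcomp Require Import measurable_realfun ring lra zify.
Import Order.TTheory GRing.Theory Num.Theory.
Import numFieldNormedType.Exports.
Local Open Scope classical_set_scope.
Local Open Scope ring_scope.

Set Implicit Arguments.
Unset Strict Implicit.
Unset Printing Implicit Defensive.

(** * Integrals of integrable real functions on a probability space *)

Section Integration.
Context (d : measure_display) (Omega : measurableType d) (R : realType)
  (P : probability Omega R).
Implicit Types (f g : Omega -> R).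

Definition L1 f : Prop := P.-integrable setT (EFin \o f).

Definition esp f : R := \int[P]_w f w.

Lemma L1_measurable f : L1 f -> measurable_fun setT f.
Proof. by move=> /integrableP[/measurable_EFinP]. Qed.

Lemma measurable_lt_set f g : measurable_fun setT f -> measurable_fun setT g ->
  measurable [set w | f w < g w].
Proof.
move=> mf mg; rewrite -[X in measurable X]setTI.
rewrite [X in _ `&` X](_ : _ = [set w | ((f w)%:E < (g w)%:E)%E])//.
by apply: measurable_lte => //; exact/measurable_EFinP.
Qed.

Lemma L1_le f g : measurable_fun setT f -> L1 g ->
  (forall w, `|f w| <= `|g w|) -> L1 f.
Proof.
move=> mf ig fg; apply: le_integrable ig => //; first exact/measurable_EFinP.
by move=> w _ /=; rewrite lee_fin.
Qed.

Lemma L1_cst c : L1 (fun=> c).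
Proof. exact: finite_measure_integrable_cst. Qed.

Lemma esp_cst c : esp (fun=> c) = c.
Proof. by rewrite /esp Rintegral_cst//= [X in fine X]probability_setT mulr1. Qed.

Lemma L1D f g : L1 f -> L1 g -> L1 (fun w => f w + g w).
Proof. by move=> fi gi; exact: (integrableD measurableT fi gi). Qed.

Lemma espD f g : L1 f -> L1 g -> esp (fun w => f w + g w) = esp f + esp g.
Proof. by move=> fi gi; exact: RintegralD. Qed.

Lemma L1Z c f : L1 f -> L1 (fun w => c * f w).
Proof. by move=> fi; exact: (integrableZl measurableT c fi). Qed.

Lemma espZ c f : L1 f -> esp (fun w => c * f w) = c * esp f.
Proof. by move=> fi; exact: RintegralZl. Qed.

Lemma L1B f g : L1 f -> L1 g -> L1 (fun w => f w - g w).
Proof. by move=> fi gi; exact: (integrableB measurableT fi gi). Qed.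

Lemma espB f g : L1 f -> L1 g -> esp (fun w => f w - g w) = esp f - esp g.
Proof. by move=> fi gi; exact: RintegralB. Qed.

Lemma L1_sum (F : nat -> Omega -> R) n : (forall i, L1 (F i)) ->
  L1 (fun w => \sum_(i < n) F i w).
Proof.
move=> iF; elim: n => [|n IHn].
  rewrite (_ : (fun w => _) = cst 0); first exact: L1_cst.
  by apply/funext => w; rewrite big_ord0.
rewrite (_ : (fun w => _) = (fun w => \sum_(i < n) F i w + F n w)); first exact: L1D.
by apply/funext => w; rewrite big_ord_recr.
Qed.

Lemma esp_sum (F : nat -> Omega -> R) n : (forall i, L1 (F i)) ->
  esp (fun w => \sum_(i < n) F i w) = \sum_(i < n) esp (F i).
Proof.
move=> iF; elim: n => [|n IHn].
  rewrite big_ord0 -[RHS](esp_cst 0); congr esp.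
  by apply/funext => w; rewrite big_ord0.
rewrite big_ord_recr/= -IHn -espD//; last exact: L1_sum.
by congr esp; apply/funext => w; rewrite big_ord_recr.
Qed.

Lemma L1_max f g : L1 f -> L1 g -> L1 (fun w => Num.max (f w) (g w)).
Proof.
move=> fi gi; apply: (@L1_le _ (fun w => `|f w| + `|g w|)).
- by apply: measurable_maxr; exact: L1_measurable.
- by apply: L1D; exact: integrable_norm.
- by move=> w; rewrite [leRHS]ger0_norm ?addr_ge0//; case: (leP (f w) (g w)) => _;
    rewrite ?lerDl ?lerDr.
Qed.

Lemma L1_min f g : L1 f -> L1 g -> L1 (fun w => Num.min (f w) (g w)).
Proof.
move=> fi gi; apply: (@L1_le _ (fun w => `|f w| + `|g w|)).
- by apply: measurable_minr; exact: L1_measurable.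
- by apply: L1D; exact: integrable_norm.
- by move=> w; rewrite [leRHS]ger0_norm ?addr_ge0//; case: (leP (f w) (g w)) => _;
    rewrite ?lerDl ?lerDr.
Qed.

Lemma esp_ge0 f : (forall w, 0 <= f w) -> 0 <= esp f.
Proof. by move=> f0; apply: Rintegral_ge0. Qed.

(** The maximum of [f] and [g] dominates [f] everywhere and agrees with [g] almost everywhere, so it
    has the integral of [g]. *)
Lemma esp_ae_le f g : L1 f -> L1 g -> {ae P, forall w, f w <= g w} ->
  esp f <= esp g.
Proof.
move=> fi gi fg; apply: (@le_trans _ _ (esp (fun w => Num.max (f w) (g w)))).
  apply: le_Rintegral => //; first exact: L1_max.
  by move=> w _; rewrite le_max lexx.
rewrite le_eqVlt; apply/orP; left; apply/eqP; congr fine.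
apply: ae_eq_integral => //.
- by apply/measurable_EFinP/L1_measurable/L1_max.
- exact/measurable_EFinP/L1_measurable.
- by apply: filterS fg => w fgw _; congr EFin; apply/max_idPr.
Qed.

Lemma esp_le f g : L1 f -> L1 g -> (forall w, f w <= g w) -> esp f <= esp g.
Proof. by move=> fi gi fg; apply: esp_ae_le => //; exact: aeW. Qed.

Definition pr (A : set Omega) : R := fine (P A).

Lemma L1_indic A : measurable A -> L1 (\1_A).
Proof. by move=> mA; exact: integrable_indic. Qed.

Lemma esp_indic A : measurable A -> esp (\1_A) = pr A.
Proof. by move=> mA; rewrite /esp /Rintegral integral_indic// setIT. Qed.

Lemma prE A : measurable A -> P A = (pr A)%:E.
Proof. by move=> mA; rewrite fineK// fin_num_measure. Qed.

Lemma pr_ae_le A B : measurable A -> measurable B ->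
  {ae P, forall w, A w -> B w} -> pr A <= pr B.
Proof.
move=> mA mB AB; rewrite -!esp_indic//; apply: esp_ae_le; try exact: L1_indic.
apply: filterS AB => w AB; rewrite !indicE ler_nat.
by have [/set_mem/AB/mem_set->|//] := boolP (w \in A).
Qed.

Lemma pr_le A B : measurable A -> measurable B -> A `<=` B -> pr A <= pr B.
Proof. by move=> mA mB AB; apply: pr_ae_le => //; apply: aeW. Qed.

Lemma pr_ge0 A : 0 <= pr A.
Proof. exact: fine_ge0. Qed.

Lemma pr_setU A B : measurable A -> measurable B ->
  pr (A `|` B) <= pr A + pr B.
Proof.
move=> mA mB; rewrite -lee_fin EFinD -!prE//; last exact: measurableU.
exact: measureU2.
Qed.

Lemma pr_bigcup (F : nat -> set Omega) n : (forall i, measurable (F i)) ->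
  pr (\big[setU/set0]_(i < n) F i) <= \sum_(i < n) pr (F i).
Proof.
move=> mF; elim: n => [|n IHn]; first by rewrite !big_ord0 /pr measure0.
rewrite !big_ord_recr/=; apply: (le_trans (pr_setU _ _)) => //.
  exact: bigsetU_measurable.
by rewrite lerD2r.
Qed.

Lemma cvg_pr_bigcap (F : nat -> set Omega) (e : R) :
  (forall n, measurable (F n)) -> (forall n, F n.+1 `<=` F n) ->
  {ae P, forall w, ~ (forall n, F n w)} -> 0 < e -> exists n, pr (F n) <= e.
Proof.
move=> mF dF F0 e0.
have mI : measurable (\bigcap_n F n) by exact: bigcapT_measurable.
have P0 : pr (\bigcap_n F n) = 0.
  apply/eqP; rewrite eq_le pr_ge0 andbT -[leRHS](_ : pr set0 = 0); last first.
    by rewrite /pr measure0.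
  by apply: pr_ae_le => //; apply: filterS F0 => w + Fw; apply => n; exact: Fw.
have : (P \o F) @ \oo --> P (\bigcap_n F n).
  apply: nonincreasing_cvg_mu => //; last first.
    by apply/nonincreasing_seqP => n; apply/subsetPset.
  exact: le_lt_trans (probability_le1 P (mF _)) (ltry _).
rewrite [P (\bigcap_n F n)](prE mI) P0 => /fine_cvgP[_ /cvgrPdist_le].
move=> /(_ _ e0)[N _ /(_ N (leqnn _))].
rewrite /= sub0r normrN => h; exists N.
by apply: le_trans h; exact: ler_norm.
Qed.

Lemma cvg_esp (F : nat -> Omega -> R) g (e : R) :
  (forall n, L1 (F n)) -> L1 g -> (forall n w, 0 <= F n w <= g w) ->
  {ae P, forall w, F ^~ w @ \oo --> 0} -> 0 < e ->
  exists N, forall n, (N <= n)%N -> esp (F n) <= e.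
Proof.
move=> iF ig Fg F0 e0.
have [||||_ _ cv] := @dominated_convergence _ _ _ P setT measurableT
  (fun n => EFin \o F n) (cst 0%E) (EFin \o g) _ _ _ ig.
- by move=> n; exact/measurable_EFinP/L1_measurable.
- exact: measurable_cst.
- apply: filterS F0 => w Fw _; exact: (cvg_comp _ _ Fw).
- apply: aeW => w n _ /=; rewrite lee_fin.
  by have /andP[F0w Fgw] := Fg n w; rewrite ger0_norm.
move: cv; rewrite integral0 => /fine_cvgP[_ /cvgrPdist_le /(_ _ e0)[N _ h]].
exists N => n /h /=; rewrite sub0r normrN; apply: le_trans; exact: ler_norm.
Qed.

(** Since [Q] is monotone in [e], the countably many values 1/(k+1) suffice. *)
Lemma ae_forall_pos (Q : R -> Omega -> Prop) :
  (forall e e' w, e <= e' -> Q e w -> Q e' w) ->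
  (forall e, 0 < e -> {ae P, forall w, Q e w}) ->
  {ae P, forall w, forall e, 0 < e -> Q e w}.
Proof.
move=> Qle hQ.
have hk (k : nat) : {ae P, forall w, Q k.+1%:R^-1 w}.
  by apply: hQ; rewrite invr_gt0.
have := ae_foralln hk; apply: filterS => w hw e e0.
have [k _ /(_ k (leqnn k)) /= ke] := near_infty_natSinv_lt (PosNum e0).
exact: Qle (ltW ke) (hw k).
Qed.

End Integration.

(** * Upper half of Birkhoff's theorem *)

Section MeasurePreserving.
Context (d : measure_display) (Omega : measurableType d) (R : realType)
  (P : probability Omega R).

Lemma measure_preserving_iter (T : Omega -> Omega) n :
  measure_preserving P T -> measure_preserving P (iter n T).
Proof.
move=> [mT PT]; elim: n => [|n [mTn PTn]]; first by split=> //; exact: measurable_id.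
split; first exact: (measurableT_comp mT mTn).
move=> A mA; rewrite -[RHS]PT// -[RHS]PTn//.
by rewrite -[X in measurable X]setTI; exact: mT.
Qed.

Context (T : Omega -> Omega).
Hypothesis mpT : measure_preserving P T.

Let mT : measurable_fun setT T := mpT.1.

Let pushforwardE (f : Omega -> \bar R) :
  (\int[pushforward P T]_w f w = \int[P]_w f w)%E.
Proof. by apply: eq_measure_integral => A mA _; exact: mpT.2. Qed.

Lemma L1_comp f : L1 P f -> L1 P (f \o T).
Proof.
move=> fi; have mf := L1_measurable fi.
apply/integrableP; split; first by apply/measurable_EFinP/measurableT_comp.
rewrite -(ge0_integral_pushforward mT P (D := setT) (f := abse \o (EFin \o f)))//.
  by rewrite pushforwardE; case/integrableP: fi.
  by apply/measurableT_comp => //; exact/measurable_EFinP.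
by move=> w _; exact: abse_ge0.
Qed.

Lemma esp_comp f : L1 P f -> esp P (f \o T) = esp P f.
Proof.
move=> fi; rewrite /esp /Rintegral; congr fine.
rewrite -[RHS]pushforwardE integral_pushforward//.
- by have /integrableP[] := fi.
- rewrite preimage_setT; exact: (L1_comp fi).
Qed.

Lemma ae_comp (Q : Omega -> Prop) :
  {ae P, forall w, Q w} -> {ae P, forall w, Q (T w)}.
Proof.
move=> [N [mN N0 QN]]; exists (T @^-1` N); split.
- by rewrite -[X in measurable X]setTI; exact: mT.
- by rewrite -[RHS]N0; exact: mpT.2.
- by move=> w Qw; exact: QN.
Qed.

End MeasurePreserving.

Definition birkhoff (R : realType) (Omega : Type) (T : Omega -> Omega)
  (f : Omega -> R) n w : R := \sum_(i < n) f (iter i T w).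

Section Ergodic.
Context (d : measure_display) (Omega : measurableType d) (R : realType)
  (P : probability Omega R) (T : Omega -> Omega).
Hypothesis erg : ergodic P T.

Let mpT : measure_preserving P T := erg.1.

Lemma birkhoffS f n w :
  birkhoff T f n.+1 w = f w + birkhoff T f n (T w) :> R.
Proof.
rewrite /birkhoff big_ord_recl/=; congr (_ + _).
by apply: eq_bigr => i _; rewrite -iterSr.
Qed.

Lemma L1_birkhoff f n : L1 P f -> L1 P (birkhoff T f n).
Proof.
move=> fi; apply: (L1_sum (F := fun i w => f (iter i T w))) => i.
exact: (L1_comp (measure_preserving_iter i mpT)).
Qed.

Lemma esp_birkhoff f n : L1 P f -> esp P (birkhoff T f n) = n%:R * esp P f.
Proof.
move=> fi; have iP i := measure_preserving_iter i mpT.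
rewrite (esp_sum (F := fun i w => f (iter i T w))) => [|i].
  rewrite (eq_bigr (fun=> esp P f)) => [|i _]; last by rewrite -(esp_comp (iP i) fi).
  by rewrite sumr_const card_ord mulr_natl.
exact: (L1_comp (iP i)).
Qed.

(** The maximum of the Birkhoff sums of lengths 1 to n+1, in a recursive form: level n+1 is [f] plus
    the positive part of level n composed with [T]. *)
Fixpoint maxbirkhoff (f : Omega -> R) n w : R :=
  if n is m.+1 then f w + Num.max 0 (maxbirkhoff f m (T w)) else f w.

Lemma maxbirkhoff_ge f n k w : (k <= n)%N ->
  birkhoff T f k.+1 w <= maxbirkhoff f n w.
Proof.
elim: n k w => [|n IHn] [|k] w //= kn; rewrite birkhoffS.
- by rewrite /birkhoff big_ord0 addr0.
- by rewrite /birkhoff big_ord0 lerD2l le_max lexx.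
- by rewrite lerD2l le_max IHn// orbT.
Qed.

Lemma maxbirkhoff_nd f n w : maxbirkhoff f n w <= maxbirkhoff f n.+1 w.
Proof.
elim: n w => [|n IHn] w; first by rewrite /= lerDl le_max lexx.
by rewrite /= lerD2l ge_max !le_max lexx /= [X in _ || X]IHn orbT.
Qed.

Lemma L1_maxbirkhoff f n : L1 P f -> L1 P (maxbirkhoff f n).
Proof.
move=> fi; elim: n => [//|n IHn]; apply: L1D => //.
apply: L1_max; first exact: L1_cst.
exact: (L1_comp mpT IHn).
Qed.

(* The set where the Birkhoff sums are unbounded is strictly invariant. Were it
   of full measure, the negative parts of the maximal sums [M n] would tend to
   0, while [esp f + esp (M n)^- = esp (M n.+1) - esp (M n) >= 0]. *)
Lemma birkhoff_bounded f : L1 P f -> esp P f < 0 ->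
  {ae P, forall w, exists C, forall n, birkhoff T f n w <= C}.
Proof.
move=> fi f0.
pose E := \bigcap_(C : nat) \bigcup_(n : nat) [set w | C%:R < birkhoff T f n w].
have mE : measurable E.
  apply: bigcapT_measurable => C; apply: bigcupT_measurable => n.
  apply: measurable_lt_set; first exact: measurable_cst.
  exact: L1_measurable (L1_birkhoff _ _).
(* Sums at [w] and at [T w] differ by the fixed number [f w], which only shifts the threshold. *)
have TE : T @^-1` E = E.
  apply/seteqP; split => w Ew C _.
  - have [n _ /= Cn] := Ew (Num.bound (C%:R - f w)) I.
    exists n.+1 => //=; rewrite birkhoffS.
    have := unstable.ltr_bound (C%:R - f w); lra.
  - have [n _ /= Cn] := Ew (Num.bound (C%:R + f w)) I.
    case: n Cn => [|n]; first by rewrite /birkhoff big_ord0 ltNge ler0n.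
    rewrite birkhoffS => Cn; exists n => //=.
    have := unstable.ltr_bound (C%:R + f w); lra.
case: (erg.2 E mE TE) => PE.
  exists E; split => // w Ew C _; apply: contrapT => nC.
  apply: Ew => /=; exists C%:R => n; rewrite leNgt; apply/negP => Cn; apply: nC.
  by exists n.
exfalso.
pose M := maxbirkhoff f.
pose F n w := Num.max 0 (- M n w).
have iM n : L1 P (M n) by exact: L1_maxbirkhoff.
have LN g : L1 P g -> L1 P (fun w => - g w).
  move=> /(L1Z (-1)); congr (L1 P).
  by apply/funext => w; rewrite mulN1r.
have iF n : L1 P (F n) by apply: L1_max; [exact: L1_cst|exact: LN].
have Mf n w : f w <= M n w.
  by have := maxbirkhoff_ge f w (leq0n n); rewrite /birkhoff big_ord1.
have [||||N /(_ N (leqnn N)) FN] :=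
    @cvg_esp _ _ _ P F (fun w => Num.max 0 (- f w)) (- esp P f / 2) iF.
- by apply: L1_max; [exact: L1_cst|exact: LN].
- move=> n w; rewrite le_max lexx /= ge_max !le_max lexx/= lerN2.
  by apply/orP; right.
- have : {ae P, forall w, E w}.
    exists (~` E); split => //; first exact: measurableC.
    by rewrite probability_setC// PE subee.
  (* On [E] some sum of positive length is positive; all later maxima are then nonnegative and their
     negative parts vanish. *)
  apply: filterS => w Ew; have [n _ /= n0] := Ew 0%N I.
  case: n n0 => [|n n0]; first by rewrite /birkhoff big_ord0 ltxx.
  apply: cvg_near_cst; exists n => // m nm; apply/max_idPl.
  by rewrite oppr_le0 (le_trans (ltW n0))// maxbirkhoff_ge.
- by lra.
have : esp P (M N) <= esp P (M N.+1).
  by apply: esp_le => // w; exact: maxbirkhoff_nd.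
(* Here x^+ = x + x^- is used. By invariance it yields [esp P (F N) >= - esp P f], against the bound
   [- esp P f / 2] chosen above. *)
have -> : M N.+1 = fun w => f w + ((M N \o T) w + (F N \o T) w).
  apply/funext => w; rewrite /F /= -/M; congr (_ + _).
  by case: (leP 0 (M N (T w))) => h; case: (leP 0 (- M N (T w))) => h'; lra.
have iMT := L1_comp mpT (iM N); have iFT := L1_comp mpT (iF N).
rewrite espD//; last exact: L1D.
rewrite espD// !esp_comp//; lra.
Qed.

(** The function [f - (esp P f + e)] has mean [-e < 0], so [birkhoff_bounded] applies to it. *)
Lemma birkhoff_le f : L1 P f -> {ae P, forall w, forall e : R, 0 < e ->
  exists C, forall n, birkhoff T f n w <= n%:R * (esp P f + e) + C}.
Proof.
move=> fi.
apply: ae_forall_pos => [e e' w ee' [C hC]|e e0].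
  by exists C => n; apply: (le_trans (hC n)); rewrite lerD2r ler_wpM2l// lerD2l.
have cg : L1 P (fun=> esp P f + e) by exact: L1_cst.
have gi : L1 P (fun w => f w - (esp P f + e)) by exact: L1B.
have : esp P (fun w => f w - (esp P f + e)) < 0.
  by rewrite espB// esp_cst opprD addrA subrr add0r oppr_lt0.
move=> /(birkhoff_bounded gi); apply: filterS => w [C hC]; exists C => n.
have := hC n; rewrite /birkhoff sumrB sumr_const card_ord -[_ *+ n]mulr_natl.
by rewrite lerBlDl.
Qed.

(** The value at time n is the sum of length n+1 of [f] plus the sum of length n of [-f]. Both are
    bounded above by [birkhoff_le], and the two means cancel. *)
Lemma iter_sublinear f : L1 P f -> {ae P, forall w, forall e : R, 0 < e ->
  exists C, forall n, f (iter n T w) <= n%:R * e + C}.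
Proof.
move=> fi; have Nfi := L1Z (-1) fi.
apply: filterS2 (birkhoff_le fi) (birkhoff_le Nfi) => w h1 h2 e e0.
have [C1 hC1] := h1 (e / 2) ltac:(lra); have [C2 hC2] := h2 (e / 2) ltac:(lra).
exists (C1 + C2 + esp P f + e / 2) => n.
have := hC1 n.+1; have := hC2 n.
rewrite /birkhoff big_ord_recr/= -mulr_sumr espZ// -[n.+1%:R]natr1; lra.
Qed.

End Ergodic.

(** * Integrable subadditive cocycles *)

Lemma cvg_sublinear (R : realType) (x : nat -> R) :
  (forall e : R, 0 < e -> exists C, forall n, x n <= n%:R * e + C) ->
  n%:R^-1 * Num.max 0 (x n) @[n --> \oo] --> 0.
Proof.
move=> hx; apply/cvgrPdist_le => e e0; have [|C hC] := hx (e / 2); first lra.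
exists (Num.bound (2 * C / e)).+1 => // n /= hn; rewrite sub0r normrN.
have n0 : 0 < n%:R :> R by rewrite ltr0n; apply: leq_ltn_trans hn.
have nC : C <= n%:R * (e / 2).
  have : 2 * C / e < n%:R.
    by apply: (lt_le_trans (unstable.ltr_bound _)); rewrite ler_nat ltnW.
  rewrite ltr_pdivrMr//; nra.
rewrite ger0_norm; last by rewrite mulr_ge0// ?invr_ge0// le_max lexx.
rewrite ler_pdivrMl// ge_max mulr_ge0 ?ler0n ?(ltW e0)//=.
by have := hC n; lra.
Qed.

Section Subadditive.
Context (d : measure_display) (Omega : measurableType d) (R : realType)
  (P : probability Omega R) (T : Omega -> Omega) (b : nat -> Omega -> R).

(** Required along the whole forward orbit, so that one null set serves all indices and the property
    passes to the iterates of [w]. *)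
Definition subadditive_at w : Prop :=
  forall n m i, b (n + m) (iter i T w) <=
                b n (iter i T w) + b m (iter (n + i) T w).

Lemma subadditive_at_iter j w : subadditive_at w -> subadditive_at (iter j T w).
Proof. by move=> sw n m i; rewrite -!iterD -addnA; exact: sw. Qed.

Lemma subadditive_birkhoff n w : b 0%N w = 0 -> subadditive_at w ->
  b n w <= birkhoff T (b 1%N) n w.
Proof.
move=> b0 sw; elim: n => [|n IHn]; first by rewrite b0 /birkhoff big_ord0.
rewrite -addn1 (le_trans (sw n 1%N 0%N))// /birkhoff addn1 big_ord_recr/= addn0.
by rewrite lerD2r.
Qed.

(* Telescoping [sum_(i < m) b (n.+1 + i) - sum_(i < m) b (n + i)]
   [= b (n + m) - b n] replaces the usual averaging over residues mod [m]. *)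
Lemma subadditive_birkhoff_avg m n w : subadditive_at w ->
  m%:R * b (n + m)%N w <= \sum_(i < m) b i w + birkhoff T (b m) n w
    + \sum_(i < m) b (m - i)%N (iter i T (iter n T w)).
Proof.
move=> sw.
have W k : \sum_(i < m) b (k + i)%N w <= \sum_(i < m) b i w + birkhoff T (b m) k w.
  elim: k => [|k IHk]; first by rewrite /birkhoff big_ord0 addr0.
  have : \sum_(i < m) b (k.+1 + i)%N w + b k w =
         \sum_(i < m) b (k + i)%N w + b (k + m)%N w.
    transitivity (\sum_(i < m.+1) b (k + i)%N w); last by rewrite big_ord_recr.
    rewrite big_ord_recl/= addn0 addrC; congr (_ + _).
    by apply: eq_bigr => i _; rewrite /bump/= add1n addSnnS.
  have := sw k m 0%N; rewrite addn0 /birkhoff big_ord_recr/= -/(birkhoff _ _ _ _).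
  rewrite /birkhoff in IHk *; lra.
(* Splitting at each time n + i bounds [b (n + m)]; adding these m bounds gives the factor m. *)
apply: (@le_trans _ _ (\sum_(i < m)
    (b (n + i)%N w + b (m - i)%N (iter i T (iter n T w))))).
  rewrite mulr_natl -[X in _ *+ X]card_ord -sumr_const; apply: ler_sum => i _.
  have := sw (n + i)%N (m - i)%N 0%N.
  by rewrite addn0 -addnA subnKC 1?ltnW// -iterD [in iter (n + i)%N T w]addnC.
by rewrite big_split/= lerD2r.
Qed.

Hypothesis erg : ergodic P T.
Hypothesis ib : forall n, L1 P (b n).
Hypothesis b0 : forall w, b 0%N w = 0.
Hypothesis bsub : {ae P, forall w, subadditive_at w}.
Hypothesis b_inf : forall e : R, 0 < e ->
  exists2 m, (0 < m)%N & esp P (b m) <= e * m%:R.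

Let mpT : measure_preserving P T := erg.1.
Let mpTn n : measure_preserving P (iter n T) := measure_preserving_iter n mpT.

(** Choose [m] with the mean of [b m] at most [e / 3 * m] and divide the averaged bound by [m]: the
    Birkhoff sum has slope at most [2 * e / 3], and the boundary term [H], taken far along the
    orbit, slope [e / 3]. *)
Lemma subadditive_sublinear : {ae P, forall w, forall e : R, 0 < e ->
  exists C, forall n, b n w <= n%:R * e + C}.
Proof.
apply: ae_forall_pos => [e e' w ee' [C hC]|e e0].
  by exists C => n; apply: (le_trans (hC n)); rewrite lerD2r ler_wpM2l.
have [|m m0 bm] := b_inf (e := e / 3); first by lra.
pose H w := \sum_(i < m) b (m - i)%N (iter i T w).
have iH : L1 P H.
  apply: (L1_sum (F := fun i w => b (m - i)%N (iter i T w))) => i.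
  exact: (L1_comp (mpTn i)).
have mR : 0 < m%:R :> R by rewrite ltr0n.
apply: (filterS3 _ _ bsub (birkhoff_le erg (ib m)) (iter_sublinear erg iH)).
move=> w sw /(_ (e / 3 * m%:R)) [|C1 h1]; first by apply: mulr_gt0 => //; lra.
move=> /(_ (e / 3 * m%:R)) [|C2 h2]; first by apply: mulr_gt0 => //; lra.
pose W := \sum_(i < m) b i w.
(* The sum of absolute values takes care of the finitely many n < m. *)
exists (`|(W + C1 + C2) / m%:R| + \sum_(i < m) `|b i w|) => n.
have S0 : 0 <= \sum_(i < m) `|b i w| by apply: sumr_ge0.
have [nm|mn] := ltnP n m.
  apply: (@le_trans _ _ (\sum_(i < m) `|b i w|)).
    rewrite (bigD1 (Ordinal nm))//=; apply: (le_trans (ler_norm _)).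
    by rewrite lerDl; apply: sumr_ge0.
  rewrite -[leLHS]add0r addrA lerD2r addr_ge0// mulr_ge0//; exact: ltW.
have := subadditive_birkhoff_avg m (n - m) sw.
rewrite subnK// -/W => h; have {}h1 := h1 (n - m)%N; have {}h2 := h2 (n - m)%N.
have kn : (n - m)%:R <= n%:R :> R by rewrite ler_nat leq_subr.
have k0 : 0 <= (n - m)%:R :> R by [].
suff : b n w <= (n - m)%:R * e + (W + C1 + C2) / m%:R.
  have := ler_norm ((W + C1 + C2) / m%:R); nra.
rewrite -(ler_pM2l mR) mulrDr [_ * (_ / _)]mulrC divfK ?gt_eqF//.
apply: (le_trans h); move: h1 h2; rewrite -/(H _).
set k := (n - m)%:R in k0 *; set M := m%:R in bm *.
nra.
Qed.

(** Truncation supplies the domination: the quotients b(n)^+ / n cut at height [K] are bounded and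
    tend to 0 almost everywhere, while the excess is controlled by Birkhoff sums of [r K], whose
    mean is at most [e / 2] per step. *)
Lemma subadditive_pos_part (e : R) : 0 < e ->
  exists2 s, (0 < s)%N & esp P (fun w => Num.max 0 (b s w)) <= e * s%:R.
Proof.
move=> e0; pose g w := Num.max 0 (b 1%N w).
have L0 : L1 P (fun=> 0) by exact: L1_cst.
have ig : L1 P g by exact: L1_max.
pose r K w := g w - Num.min (g w) K%:R.
have ir K : L1 P (r K) by apply: L1B => //; apply: L1_min => //; exact: L1_cst.
have g0 w : 0 <= g w by rewrite le_max lexx.
have [|||K /(_ K (leqnn K)) rK] := @cvg_esp _ _ _ P r g (e / 2) ir ig.
- by move=> K w; rewrite /r; case: (leP (g w) K%:R) => h; have := g0 w;
    have : 0 <= K%:R :> R by []; lra.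
- apply: aeW => w; apply: cvg_near_cst; exists (Num.bound (g w)) => // K /= hK.
  rewrite /r (min_idPl _) ?subrr//.
  by rewrite (le_trans (ltW (unstable.ltr_bound (g w))))// ler_nat.
- by lra.
pose F n w := Num.min (n%:R^-1 * Num.max 0 (b n w)) K%:R.
have imax n : L1 P (fun w => Num.max 0 (b n w)) by exact: L1_max.
have iF n : L1 P (F n) by apply: L1_min; [exact: L1Z|exact: L1_cst].
have [|||N hN] := @cvg_esp _ _ _ P F (fun=> K%:R) (e / 2) iF (L1_cst P _).
- move=> n w; rewrite /F ge_min lexx orbT andbT le_min ler0n andbT.
  by rewrite mulr_ge0// ?invr_ge0// le_max lexx.
- apply: filterS subadditive_sublinear => w hw.
  have := cvg_sublinear hw.
  move=> /cvgrPdist_le cv; apply/cvgrPdist_le => x x0.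
  have [n0 _ hn0] := cv _ x0; exists n0 => // n /hn0 /=.
  rewrite !sub0r !normrN; apply: le_trans.
  have p0 : 0 <= n%:R^-1 * Num.max 0 (b n w).
    by rewrite mulr_ge0// ?invr_ge0// le_max lexx.
  rewrite !ger0_norm//; first by rewrite /F ge_min lexx.
  by rewrite /F le_min p0 ler0n.
- by lra.
exists N.+1 => //; have {}hN := hN N.+1 (leqnSn N).
set s := N.+1 in hN *; have s0 : 0 < s%:R :> R by rewrite ltr0n.
(* If the cut is inactive, [s%:R * F s w] is already b(s)^+. Otherwise it is s K, and summing
   [b 1 <= K + r K] along the orbit gives the bound. *)
apply: (@le_trans _ _ (esp P (fun w => s%:R * F s w + birkhoff T (r K) s w))).
  apply: esp_ae_le => //.
    by apply: L1D; [exact: L1Z|exact: L1_birkhoff].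
  apply: filterS bsub => w sw.
  have S0 : 0 <= birkhoff T (r K) s w.
    by apply: sumr_ge0 => i _; rewrite /r subr_ge0 ge_min lexx.
  rewrite /F; case: (leP (s%:R^-1 * _) K%:R) => _.
    by rewrite mulrA divff ?gt_eqF// mul1r lerDl.
  rewrite ge_max addr_ge0 ?mulr_ge0 ?ler0n//=.
  apply: (le_trans (subadditive_birkhoff s (b0 w) sw)).
  rewrite mulr_natl -[X in _ *+ X]card_ord -sumr_const /birkhoff -big_split/=.
  apply: ler_sum => i _; rewrite /r /g.
  set x := b _ _; have : Num.min (Num.max 0 x) K%:R <= K%:R by rewrite ge_min lexx orbT.
  have : x <= Num.max 0 x by rewrite le_max lexx orbT.
  lra.
rewrite espD; [|exact: L1Z|exact: L1_birkhoff].
rewrite espZ// esp_birkhoff//; nra.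
Qed.

End Subadditive.

(** * Bad times *)

Section BadReturns.
Context (d : measure_display) (Omega : measurableType d) (R : realType)
  (P : probability Omega R) (T : Omega -> Omega) (b : nat -> Omega -> R).
Hypothesis erg : ergodic P T.
Hypothesis ib : forall n, L1 P (b n).
Hypothesis b0 : forall w, b 0%N w = 0.
Hypothesis bsub : {ae P, forall w, subadditive_at T b w}.
Hypothesis b_ge0 : forall n, 0 <= esp P (b n).

Let mpT : measure_preserving P T := erg.1.
Let mpTn n : measure_preserving P (iter n T) := measure_preserving_iter n mpT.

(* Truncated subtraction: for [n < s] this reads [b n w <= b n w + b 0 _]. *)
Lemma subadditive_minn n s w : subadditive_at T b w ->
  b n w <= b (minn n s) w + b (n - s)%N (iter s T w).
Proof.
move=> sw; have [ns|sn] := leqP n s.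
  by rewrite (eqP ns) b0 addr0.
by have := sw s (n - s)%N 0%N; rewrite subnKC ?addn0// ltnW.
Qed.

(** * Potential along steps of fixed length *)

Section Potential.
Context (s : nat) (kap : R).
Hypothesis kap0 : 0 <= kap.

(* [potential i n w] is the maximum over [j <= i] of
   [b (n - j * s) (T^(j * s) w) - j * kap]. *)
Fixpoint potential i n w : R :=
  if i is j.+1
  then Num.max (b n w) (potential j (n - s)%N (iter s T w) - kap) else b n w.

Lemma potential_ge j i n w : (j <= i)%N ->
  b (n - j * s)%N (iter (j * s) T w) - j%:R * kap <= potential i n w.
Proof.
elim: i j n w => [|i IHi] [|j] n w //= ji; rewrite ?mul0n ?mul0r ?subn0 ?subr0//.
  by rewrite /= le_max lexx.
rewrite le_max; apply/orP; right.
have := IHi j (n - s)%N (iter s T w) ji.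
rewrite -iterD -subnDA -mulSn [X in iter X]addnC -mulSn -[j.+1%:R]natr1 mulrDl mul1r.
lra.
Qed.

Lemma potential_ge_cocycle i n w : b n w <= potential i n w.
Proof.
by have := potential_ge n w (leq0n i); rewrite mul0n mul0r subn0 subr0.
Qed.

Lemma potential_nd i n w : potential i n w <= potential i.+1 n w.
Proof.
elim: i n w => [|i IHi] n w; first by rewrite /= le_max lexx.
rewrite [leLHS]/= [leRHS]/= ge_max !le_max lexx/= -/(potential i.+1 _ _).
by rewrite lerD2r IHi orbT.
Qed.

Lemma potential0 i w : potential i 0 w = 0.
Proof.
elim: i w => [|i IHi] w /=; first exact: b0.
by rewrite sub0n IHi b0 max_l// sub0r oppr_le0.
Qed.

Lemma L1_potential i n : L1 P (potential i n).
Proof.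
elim: i n => [|i IHi] n //=; apply: L1_max => //.
by apply: L1B; [exact: (L1_comp (mpTn s) (IHi (n - s)%N))|exact: L1_cst].
Qed.

(** The event that the second entry wins the maximum defining [potential i.+1 n], so that a charge
    [kap] is paid. *)
Definition drop_set i n : set Omega :=
  [set w | b n w < potential i (n - s)%N (iter s T w) - kap].

Lemma measurable_drop_set i n : measurable (drop_set i n).
Proof.
apply: measurable_lt_set; first exact: L1_measurable (ib n).
apply: (L1_measurable (P := P)); apply: L1B; last exact: L1_cst.
exact: (L1_comp (mpTn s) (L1_potential i (n - s)%N)).
Qed.

(** On the drop set the left side equals [potential i] after one step, minus [kap]. Off it, it is
    [b n w], and splitting off the first [s] times costs at most the positive part of
    [b (minn n s)]. *)
Lemma potential_step i n w : subadditive_at T b w ->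
  potential i.+1 n w <= potential i.+1 (n - s)%N (iter s T w)
    + Num.max 0 (b (minn n s) w) - kap * \1_(drop_set i n) w.
Proof.
move=> sw; have q0 : 0 <= Num.max 0 (b (minn n s) w) by rewrite le_max lexx.
have qb : b (minn n s) w <= Num.max 0 (b (minn n s) w).
  by rewrite le_max lexx orbT.
have := potential_nd i (n - s) (iter s T w).
have := potential_ge_cocycle i.+1 (n - s) (iter s T w).
have := subadditive_minn n s sw.
rewrite indicE [potential i.+1 n w]/=.
have [wB|wB] := boolP (w \in drop_set i n).
  move/set_mem: wB => /= wB; rewrite (max_r (ltW wB)) mulr1; lra.
have {}wB : potential i (n - s) (iter s T w) - kap <= b n w.
  by rewrite leNgt; apply: contra wB => wB; exact/mem_set.
rewrite (max_l wB) mulr0; lra.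
Qed.

(** Truncated subtraction inserts terms [F 0 = 0] at the start and loses nonnegative terms at the
    end. *)
Lemma sum_subn_le (F : nat -> R) N : F 0%N = 0 -> (forall n, 0 <= F n) ->
  \sum_(n < N) F (n - s)%N <= \sum_(n < N) F n.
Proof.
elim: s F => [|t IHt] F F0 Fge0.
  by apply: ler_sum => n _; rewrite subn0.
apply: (@le_trans _ _ (\sum_(n < N) F n.-1)).
  have := IHt (fun n => F n.-1) F0 (fun n => Fge0 _).
  by apply: le_trans; apply: ler_sum => n _; rewrite subnS.
case: N {IHt} => [|N]; first by rewrite !big_ord0.
by rewrite big_ord_recl big_ord_recr/= F0 add0r lerDl.
Qed.

(** Integrate [potential_step] and sum over n < N. By invariance and [sum_subn_le] the shifted sum
    of mean potentials is at most the unshifted one, which cancels; these means are nonnegative by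
    [b_ge0]. *)
Lemma sum_pr_drop_set i N : kap * (\sum_(n < N) pr P (drop_set i n)) <=
  \sum_(n < N) esp P (fun w => Num.max 0 (b (minn n s) w)).
Proof.
pose E n := esp P (potential i.+1 n).
have iq n : L1 P (fun w => Num.max 0 (b (minn n s) w)).
  by apply: L1_max => //; exact: L1_cst.
have step n : E n <= E (n - s)%N + esp P (fun w => Num.max 0 (b (minn n s) w))
    - kap * pr P (drop_set i n).
  have mD := measurable_drop_set i n.
  have ip := L1_comp (mpTn s) (L1_potential i.+1 (n - s)).
  have iD : L1 P (fun w => kap * \1_(drop_set i n) w).
    by apply: L1Z; exact: L1_indic.
  rewrite -(esp_indic P mD) -(espZ kap (L1_indic P mD)).
  rewrite /E -(esp_comp (mpTn s) (L1_potential i.+1 (n - s))) -espD//.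
  rewrite -espB//; last exact: L1D.
  apply: esp_ae_le; [exact: L1_potential|by apply: L1B => //; exact: L1D|].
  by apply: filterS bsub => w; exact: potential_step.
have E0 : E 0%N = 0.
  rewrite /E -[RHS](esp_cst P 0); congr (esp P).
  by apply/funext => w; rewrite potential0.
have Ege0 n : 0 <= E n.
  apply: (le_trans (b_ge0 n)); apply: esp_le => //; first exact: L1_potential.
  by move=> w; exact: potential_ge_cocycle.
have := sum_subn_le N E0 Ege0.
have : \sum_(n < N) E n <= \sum_(n < N) (E (n - s)%N
    + esp P (fun w => Num.max 0 (b (minn n s) w)) - kap * pr P (drop_set i n)).
  by apply: ler_sum => n _.
rewrite sumrB big_split/= -mulr_sumr; lra.
Qed.

End Potential.

Definition bad_set n k c : set Omega :=
  \bigcup_(l in [set l | (k <= l <= n)%N])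
    [set w | b n w + c * l%:R < b (n - l)%N (iter l T w)].

Lemma measurable_lt_return n l c :
  measurable [set w | b n w + c < b (n - l)%N (iter l T w)].
Proof.
apply: measurable_lt_set.
  by apply: (L1_measurable (P := P)); apply: L1D => //; exact: L1_cst.
exact: L1_measurable (L1_comp (mpTn l) (ib (n - l)%N)).
Qed.

Lemma measurable_bad_set n k c : measurable (bad_set n k c).
Proof. by apply: bigcup_measurable => l _; exact: measurable_lt_return. Qed.

(** Unit steps need no rounding, so all l from 1 on are covered, at the price of a large slope: [c]
    exceeds [I / eta]. This later handles the short l. *)
Lemma bad_set1_bound (eta : R) : 0 < eta ->
  exists2 c : R, 0 < c & forall N, \sum_(n < N) pr P (bad_set n 1 c) <= N%:R * eta.
Proof.
move=> eta0; pose I := esp P (fun w => Num.max 0 (b 1%N w)).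
have I0 : 0 <= I by apply: esp_ge0 => w; rewrite le_max lexx.
have c0 : 0 < I / eta + 1 by rewrite ltr_wpDl// divr_ge0// ltW.
exists (I / eta + 1) => // N; set c := I / eta + 1 in c0 *.
have : \sum_(n < N) pr P (bad_set n 1 c) <=
       \sum_(n < N) pr P (drop_set 1 c N n).
  apply: ler_sum => n _; apply: pr_le.
  - exact: measurable_bad_set.
  - exact: measurable_drop_set.
  (* A return after [l.+1] is one charged step followed by [l] steps inside the potential, whose
     depth [N] is enough as l < n < N. *)
  move=> w [[//|l] /= ln]; rewrite /drop_set/=.
  have lN : (l <= N)%N by have := ltn_ord n; lia.
  have := @potential_ge 1 c l N (n - 1)%N (iter 1 T w) lN.
  rewrite muln1 -iterD -subnDA addn1 add1n -[l.+1%:R]natr1; lra.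
have : c * (\sum_(n < N) pr P (drop_set 1 c N n)) <= N%:R * I.
  apply: (le_trans (sum_pr_drop_set 1 (ltW c0) N N)).
  rewrite mulr_natl -[X in _ *+ X]card_ord -sumr_const.
  apply: ler_sum => -[[|n] nN] _ /=.
    rewrite min0n (_ : (fun w => _) = fun=> 0) ?esp_cst//.
    by apply/funext => w; rewrite b0 maxxx.
  by rewrite (_ : minn _ _ = 1%N)//; lia.
have cI : c * eta = I + eta by rewrite /c mulrDl divfK ?gt_eqF// mul1r.
move=> h1 h2; apply: (le_trans h2).
rewrite -(ler_pM2l c0); apply: (le_trans h1).
by rewrite mulrCA cI ler_wpM2l// lerDl ltW.
Qed.

End BadReturns.

(** * From rare bad times to infinitely many good times *)

Section GoodTimes.
Context (d : measure_display) (Omega : measurableType d) (R : realType)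
  (P : probability Omega R) (T : Omega -> Omega) (b : nat -> Omega -> R).
Hypothesis erg : ergodic P T.
Hypothesis ib : forall n, L1 P (b n).
Hypothesis b0 : forall w, b 0%N w = 0.
Hypothesis bsub : {ae P, forall w, subadditive_at T b w}.
Hypothesis b_ge0 : forall n, 0 <= esp P (b n).
Hypothesis b_inf : forall e : R, 0 < e ->
  exists2 m, (0 < m)%N & esp P (b m) <= e * m%:R.

Let mpT : measure_preserving P T := erg.1.
Let mpTn n : measure_preserving P (iter n T) := measure_preserving_iter n mpT.

(** A bad l is rounded up to a multiple of [s]. Half of the slope pays for the rounding, except on
    the unlikely set [Exc]; the other half is the charge [kap] per step. *)
Lemma bad_set_bound (c eta : R) : 0 < c -> 0 < eta ->
  exists k, forall N, \sum_(n < N) pr P (bad_set T b n k c) <= N%:R * eta.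
Proof.
move=> c0 eta0.
(* Divided by [kap = c / 2 * s], the bound [eta * c / 8 * s] becomes [eta / 4]. *)
have [|s s0 bs] := subadditive_pos_part erg ib b0 bsub b_inf (e := eta * c / 8).
  by rewrite divr_gt0// mulr_gt0.
have imax n : L1 P (fun w => Num.max 0 (b n w)).
  by apply: L1_max => //; exact: L1_cst.
(* A rounding gap is shorter than [s], so [h] bounds the cocycle over it. *)
pose h w := \sum_(i < s) Num.max 0 (b i w).
have ih : L1 P h by apply: (L1_sum (F := fun i w => Num.max 0 (b i w))).
pose Exc k := \bigcup_(l in [set l | (k <= l)%N])
  [set w | c / 2 * (l%:R - s%:R) < h (iter l T w)].
have mExc k : measurable (Exc k).
  apply: bigcup_measurable => l _; apply: measurable_lt_set => //.
  exact: L1_measurable (L1_comp (mpTn l) ih).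
have [|||k1 Ek1] := @cvg_pr_bigcap _ _ _ P Exc (eta / 4) mExc.
- by move=> k w [l /= kl lw]; exists l => //=; exact: ltnW.
(* Along the orbit [h] has slope at most [c / 4], hence eventually stays below the line of slope
   [c / 2]. *)
- apply: filterS (iter_sublinear erg ih) => w /(_ (c / 4)) [|C hC]; first lra.
  move=> /(_ (Num.bound (4 / c * (C + c / 2 * s%:R)))) [l /= kl].
  have : 4 / c * (C + c / 2 * s%:R) < l%:R.
    by apply: (lt_le_trans (unstable.ltr_bound _)); rewrite ler_nat.
  rewrite -(ltr_pM2l c0) mulrA mulrCA divff ?gt_eqF// => h1 h2.
  have := hC l; lra.
- lra.
pose kap := c / 2 * s%:R.
have sR : 0 < s%:R :> R by rewrite ltr0n.
have kap0 : 0 < kap by rewrite mulr_gt0// divr_gt0.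
pose D N n := drop_set T b s kap N n.
have mD N n : measurable (D N n) by exact: (measurable_drop_set erg ib).
have sub k N n : (k1 <= k)%N -> (0 < k)%N -> (n < N)%N ->
    pr P (bad_set T b n k c) <= pr P (D N n) + eta / 4.
  move=> k1k k0 nN; apply: (@le_trans _ _ (pr P (D N n `|` Exc k1))); last first.
    by apply: (le_trans (pr_setU _ _ _)) => //; rewrite lerD2l.
  apply: pr_ae_le.
  - exact: (measurable_bad_set erg ib).
  - exact: measurableU.
  apply: filterS bsub => w sw [l /= /andP[kl ln] bad].
  have [hl|hl] := ltP (c / 2 * (l%:R - s%:R)) (h (iter l T w)).
    by right; exists l => //=; exact: leq_trans kl.
  left; rewrite /D /drop_set/=.
  (* [j.+1 * s] is [l] rounded up to a multiple of [s]. *)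
  pose j := (l.-1 %/ s)%N; pose u := (j.+1 * s - l)%N.
  have [lj us] : (l + u = j.+1 * s)%N /\ (u < s)%N.
    have := divn_eq l.-1 s; have := ltn_pmod l.-1 s0.
    by rewrite /u /j; lia.
  have jN : (j <= N)%N.
    have : (j <= j * s)%N by rewrite leq_pmulr.
    by move: lj us; rewrite mulSn; lia.
  have := potential_ge T b s kap (n - s) (iter s T w) jN.
  rewrite -iterD -subnDA -mulSn [(j * s + s)%N]addnC -mulSn.
  have := subadditive_minn b0 (n - l) u (subadditive_at_iter l sw).
  rewrite -iterD -subnDA [(u + l)%N]addnC lj.
  have : b (minn (n - l) u) (iter l T w) <= h (iter l T w).
    have ms : (minn (n - l) u < s)%N by apply: leq_ltn_trans us; exact: geq_minr.
    rewrite /h (bigD1 (Ordinal ms))//= -[leLHS]addr0 lerD ?le_max ?lexx ?orbT//.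
    by apply: sumr_ge0 => i _; rewrite le_max lexx.
  have : c / 2 * (j.+1 * s)%N%:R <= c / 2 * (l%:R + s%:R).
    rewrite ler_pM2l ?divr_gt0// -natrD ler_nat -lj leq_add2l; exact: ltnW.
  rewrite natrM -[j.+1%:R]natr1 /kap; lra.
(* [C] absorbs the times n < s, where [minn n s] is n. *)
pose C := \sum_(n < s) esp P (fun w => Num.max 0 (b n w)).
have e0 n : 0 <= esp P (fun w => Num.max 0 (b n w)).
  by apply: esp_ge0 => w; rewrite le_max lexx.
have C0 : 0 <= C by apply: sumr_ge0.
have qle n : esp P (fun w => Num.max 0 (b (minn n s) w)) <=
    esp P (fun w => Num.max 0 (b s w))
    + (if (n < s)%N then esp P (fun w => Num.max 0 (b n w)) else 0).
  by case: ltnP => ns; rewrite ?addr0// lerDr.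
have Cle N : \sum_(n < N)
    (if (n < s)%N then esp P (fun w => Num.max 0 (b n w)) else 0) <= C.
  rewrite -big_mkcond/= /C; have [Ns|sN] := leqP N s.
    rewrite (eq_bigl xpredT) => [|i]; last by rewrite (leq_trans (ltn_ord i)).
    rewrite (big_ord_widen _ (fun n => esp P (fun w => Num.max 0 (b n w))) Ns).
    by rewrite [leRHS](bigID (fun i : 'I_s => (i < N)%N))/= lerDl; apply: sumr_ge0.
  by rewrite (big_ord_widen _ (fun n => esp P (fun w => Num.max 0 (b n w))) (ltnW sN)).
have sumD N : \sum_(n < N) pr P (D N n) <= N%:R * (eta / 4) + C / kap.
  rewrite -(ler_pM2l kap0).
  apply: (le_trans (sum_pr_drop_set erg ib b0 bsub b_ge0 s (ltW kap0) N N)).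
  apply: le_trans; first by apply: ler_sum => n _; exact: qle.
  rewrite big_split/= mulrDr [kap * (C / _)]mulrC divfK ?gt_eqF//.
  rewrite lerD//; last exact: Cle.
  rewrite sumr_const card_ord -[_ *+ N]mulr_natl mulrCA ler_wpM2l//.
  by apply: (le_trans bs); rewrite /kap; nra.
(* For N > K the constant [C / kap] is at most [N%:R * (eta / 2)]. For N <= K the sum vanishes,
   since no l with K <= l <= n < N exists. *)
pose k2 := Num.bound (2 * (C / kap) / eta).
pose K := (maxn k1 k2).+1; exists K => N.
have [Nk|kN] := leqP N K.
  rewrite big1 ?mulr_ge0 ?ler0n ?(ltW eta0)// => n _.
  rewrite (_ : bad_set _ _ _ _ _ = set0) ?/pr ?measure0//.
  by apply/seteqP; split => // w [l /= ln]; have := ltn_ord n; lia.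
have : C / kap <= N%:R * (eta / 2).
  have : 2 * (C / kap) / eta < N%:R.
    apply: (lt_le_trans (unstable.ltr_bound _)); rewrite ler_nat -/k2; lia.
  rewrite ltr_pdivrMr//; lra.
have := sumD N.
have : \sum_(n < N) pr P (bad_set T b n K c) <=
       \sum_(n < N) (pr P (D N n) + eta / 4).
  by apply: ler_sum => n _; apply: sub => //; rewrite /K; lia.
rewrite big_split/= sumr_const card_ord -[_ *+ N]mulr_natl; lra.
Qed.

(** Half of [eta] goes to a fixed slope [c] valid for all l; the other half is split geometrically
    among the slopes 1/(j+1), each used from its own scale [k j] on. *)
Lemma delta_bound (eta : R) : 0 < eta -> exists delta : nat -> R,
  [/\ forall l, 0 < delta l, delta @ \oo --> 0 &
   forall N, \sum_(n < N) pr P (\bigcup_(l in [set l | (0 < l <= n)%N])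
     [set w | b n w + delta l * l%:R < b (n - l)%N (iter l T w)]) <= N%:R * eta].
Proof.
move=> eta0.
have [|c c0 hc] := bad_set1_bound erg ib b0 bsub b_ge0 (eta := eta / 2); first lra.
pose eta_ (j : nat) : R := eta / 2 * 2^-1 ^+ j.+1.
have eta_0 j : 0 < eta_ j by rewrite mulr_gt0 ?exprn_gt0//; lra.
pose c_ (j : nat) : R := j.+1%:R^-1.
have c_0 j : 0 < c_ j by rewrite invr_gt0.
have /choice[k hk] : forall j, exists k, forall N,
    \sum_(n < N) pr P (bad_set T b n k (c_ j)) <= N%:R * eta_ j.
  by move=> j; exact: (bad_set_bound (c_0 j) (eta_0 j)).
(* The default [c] serves before any scale is reached. The restriction j < l keeps the minimum
   finite and later gives j < N. *)
pose delta l := \big[Num.min/c]_(j < l | (k j <= l)%N) c_ j.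
have delta_le j l : (j < l)%N -> (k j <= l)%N -> delta l <= c_ j.
  by move=> jl kl; exact: (@bigmin_le_cond _ _ _ _ (Ordinal jl)).
have delta_eq l : delta l = c \/
    exists j, [/\ (j < l)%N, (k j <= l)%N & delta l = c_ j].
  rewrite /delta; elim/big_ind : _ => [|x y hx hy|j kj]; first by left.
    by case: leP.
  by right; exists j.
exists delta; split.
- by move=> l; have [->//|[j [_ _ ->]]] := delta_eq l.
- apply/cvgrPdist_le => e e0.
  have [j _ /(_ j (leqnn j)) /= je] := near_infty_natSinv_lt (PosNum e0).
  exists (maxn j.+1 (k j)) => // l /=; rewrite geq_max => /andP[jl kl].
  rewrite sub0r normrN ger0_norm.
    exact: le_trans (delta_le _ _ jl kl) (ltW je).
  by have [->|[i [_ _ ->]]] := delta_eq l; exact: ltW.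
move=> N; set B := fun n => _.
have mbad n j : measurable (bad_set T b n (k j) (c_ j)).
  exact: (measurable_bad_set erg ib).
have mbad1 n : measurable (bad_set T b n 1 c) by exact: (measurable_bad_set erg ib).
have mbads n : measurable (\big[setU/set0]_(j < N) bad_set T b n (k j) (c_ j)).
  by apply: bigsetU_measurable => j _.
apply: (@le_trans _ _ (\sum_(n < N) (pr P (bad_set T b n 1 c) +
    \sum_(j < N) pr P (bad_set T b n (k j) (c_ j))))).
  apply: ler_sum => n _; apply: (@le_trans _ _ (pr P (bad_set T b n 1 c `|`
      \big[setU/set0]_(j < N) bad_set T b n (k j) (c_ j)))).
    apply: pr_le.
    - by apply: bigcup_measurable => l _; exact: (measurable_lt_return erg ib).
    - exact: measurableU.
    move=> w [l /= ln]; have [->|[j [jl kl ->]]] := delta_eq l; first by left; exists l.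
    have jN : (j < N)%N by have := ltn_ord n; lia.
    move=> lw; right.
    rewrite -(bigcup_mkord N (fun j => bad_set T b n (k j) (c_ j))).
    by exists j => //; exists l => //=; lia.
  apply: (le_trans (pr_setU _ _ _)) => //; rewrite lerD2l.
  exact: (pr_bigcup _ (F := fun j => bad_set T b n (k j) (c_ j))).
rewrite big_split/= exchange_big/=.
have h2 : \sum_(j < N) \sum_(n < N) pr P (bad_set T b n (k j) (c_ j)) <=
    \sum_(j < N) N%:R * eta_ j by apply: ler_sum => j _.
have gsum M : \sum_(j < M) eta_ j = eta / 2 * (1 - 2^-1 ^+ M).
  elim: M => [|M IHM]; first by rewrite big_ord0 expr0 subrr mulr0.
  rewrite big_ord_recr/= IHM /eta_ exprS; lra.
have := hc N; move: h2; rewrite -mulr_sumr gsum.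
have : N%:R * (eta / 2 * (1 - 2^-1 ^+ N)) <= N%:R * (eta / 2).
  have g0 : 0 <= 2^-1 ^+ N :> R by rewrite exprn_ge0.
  by rewrite ler_wpM2l//; nra.
lra.
Qed.

(** [F delta] is the event that only finitely many times are good for [delta]. It is unlikely when
    bad times are rare, and avoiding [F (dl j)] for a single [j] suffices, which is why [delta]
    depends on [w]. *)
Lemma ae_infinitely_many_good :
  {ae P, forall w, exists delta : nat -> R,
    [/\ forall l, 0 < delta l, delta @ \oo --> 0 &
     forall M, exists2 n, (M <= n)%N & forall l, (0 < l <= n)%N ->
       b (n - l)%N (iter l T w) <= b n w + delta l * l%:R]}.
Proof.
pose B (delta : nat -> R) n := \bigcup_(l in [set l | (0 < l <= n)%N])
  [set w | b n w + delta l * l%:R < b (n - l)%N (iter l T w)].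
have mB delta n : measurable (B delta n).
  by apply: bigcup_measurable => l _; exact: (measurable_lt_return erg ib).
pose G delta M := \bigcap_(n in [set n | (M <= n)%N]) B delta n.
have mG delta M : measurable (G delta M) by apply: bigcap_measurableType => n _; exact: mB.
pose F delta := \bigcup_M G delta M.
have mF delta : measurable (F delta) by exact: bigcupT_measurable.
have prG delta (eta : R) : 0 < eta ->
    (forall N, \sum_(n < N) pr P (B delta n) <= N%:R * eta) ->
    forall M, pr P (G delta M.+1) <= 2 * eta.
  (* In this window every time in the second half is at least M+1 and contributes at least the
     measure of [G delta M.+1]; doubling the length costs the factor 2. *)
  move=> eta0 hN M; have := hN (M.+1 + M.+1)%N.
  rewrite big_split_ord/= => h.
  have h1 : 0 <= \sum_(i < M.+1) pr P (B delta i).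
    by apply: sumr_ge0 => i _; exact: pr_ge0.
  have h2 : \sum_(i < M.+1) pr P (G delta M.+1) <=
      \sum_(i < M.+1) pr P (B delta (M.+1 + i)%N).
    apply: ler_sum => i _; apply: pr_le => //.
    by move=> w /(_ (M.+1 + i)%N); apply; rewrite /= leq_addr.
  rewrite sumr_const card_ord -[_ *+ M.+1]mulr_natl in h2.
  have M0 : 0 < M.+1%:R :> R by [].
  rewrite -(ler_pM2l M0); move: h; rewrite natrD; lra.
have prF delta (eta : R) : 0 < eta ->
    (forall N, \sum_(n < N) pr P (B delta n) <= N%:R * eta) ->
    pr P (F delta) <= 3 * eta.
  move=> eta0 hN.
  have mD M : measurable (F delta `\` G delta M.+1) by exact: measurableD.
  have [||//|M hM] := @cvg_pr_bigcap _ _ _ P (fun M => F delta `\` G delta M.+1) eta mD.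
  (* The sets [G delta M] increase to [F delta], so the differences decrease to the empty set. *)
  - move=> M w [Fw Gw]; split => // Gw'; apply: Gw => n /= Mn; apply: Gw' => /=.
    exact: ltnW.
  - apply: aeW => w h; have [[M _ Gw] _] := h 0%N.
    have [_ []] := h M; move=> n /= Mn; apply: Gw => /=; exact: ltnW.
  have : pr P (F delta) <= pr P ((F delta `\` G delta M.+1) `|` G delta M.+1).
    apply: pr_le => //; first exact: measurableU.
    by move=> w Fw; have [Gw|Gw] := pselect (G delta M.+1 w); [right|left].
  have := pr_setU P (mD M) (mG delta M.+1).
  have := prG delta eta eta0 hN M; lra.
have /choice[dl hdl] : forall j : nat, exists delta : nat -> R,
    [/\ forall l, 0 < delta l, delta @ \oo --> 0 &
     forall N, \sum_(n < N) pr P (B delta n) <= N%:R * j.+1%:R^-1].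
  by move=> j; apply: delta_bound; rewrite invr_gt0.
(* [Z] lies in each [F (dl j)], of measure at most 3/(j+1), hence is null. *)
pose Z := \bigcap_j F (dl j).
have mZ : measurable Z by exact: bigcapT_measurable.
exists Z; split => //.
  rewrite (prE P mZ); congr EFin; apply/eqP; rewrite eq_le pr_ge0 andbT.
  apply/ler_addgt0Pr => e e0; rewrite add0r.
  have e3 : 0 < e / 3 by lra.
  have [j _ /(_ j (leqnn j)) /= je] := near_infty_natSinv_lt (PosNum e3).
  have [_ _ hN] := hdl j.
  have : pr P Z <= pr P (F (dl j)) by apply: pr_le => // w; apply.
  have j0 : 0 < j.+1%:R^-1 :> R by rewrite invr_gt0.
  move=> /le_trans; apply; apply: (le_trans (prF (dl j) _ j0 hN)).
  by rewrite -ler_pdivlMl// mulrC ltW.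
move=> w /= nw j _; apply: contrapT => nF; apply: nw; exists (dl j).
have [h1 h2 _] := hdl j; split => // M.
apply: contrapT => nM; apply: nF; exists M => // n /= Mn.
apply: contrapT => nB; apply: nM; exists n => // l ln.
rewrite leNgt; apply/negP => lw; apply: nB; exists l => //.
Qed.

End GoodTimes.

(** * Reduction to average zero and the two-sided estimate *)

Theorem theorem1p1 (d : measure_display) (Omega : measurableType d) (R : realType)
  (P : probability Omega R) (T : Omega -> Omega) (a : nat -> Omega -> R) :
  ergodic P T ->
  (forall n, measurable_fun setT (a n)) ->
  (forall w, a 0%N w = 0) ->
  (forall n m : nat, (0 < n)%N -> (0 < m)%N ->
     {ae P, forall w, a (n + m)%N w <= a n w + a m (iter n T w)}) ->
  P.-integrable setT (fun w => (a 1%N w)%:E) ->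
  asymptotic_average P a \is a fin_num ->
  {ae P, forall w, exists (ni : nat -> nat) (delta : nat -> R),
     (forall M : nat, \forall i \near \oo, (M <= ni i)%N) /\
     (forall l, 0 < delta l) /\
     delta @ \oo --> 0 /\
     (forall (i l : nat), (l <= ni i)%N ->
        `| a (ni i) w - a (ni i - l)%N (iter l T w)
           - fine (asymptotic_average P a) * l%:R | <= l%:R * delta l)}.
Proof.
move=> erg ma a0 asub ia1 Afin.
have mpT := erg.1; have mpTn n := measure_preserving_iter n mpT.
set A := fine (asymptotic_average P a).
(* Zero indices follow from [a0]; the countably many null sets, pulled back by the iterates of [T],
   are united. *)
have asub_all : {ae P, forall w, subadditive_at T a w}.
  have h : {ae P, forall w, forall n m, a (n + m)%N w <= a n w + a m (iter n T w)}.
    apply: ae_foralln => n; apply: ae_foralln => m.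
    have [->|n0] := posnP n; first by apply: aeW => w; rewrite a0 add0r.
    have [->|m0] := posnP m; first by apply: aeW => w; rewrite a0 addn0 addr0.
    exact: asub.
  have := ae_foralln (fun i => ae_comp (mpTn i) h).
  by apply: filterS => w hw n m i; rewrite iterD; exact: hw.
have ia1' : L1 P (a 1%N) by exact: ia1.
have iS n : L1 P (birkhoff T (a 1%N) n) by exact: L1_birkhoff.
have A_le n : (0 < n)%N -> (A%:E <= (n%:R^-1)%:E * \int[P]_w (a n w)%:E)%E.
  by move=> n0; rewrite /A fineK//; apply: ereal_inf_lbound; exists n.
(* A finite infimum excludes [\int a n = -oo], so the negative part of [a n]
   is integrable as well. *)
have ia n : L1 P (a n).
  case: n => [|n].
    rewrite (_ : a 0%N = cst 0); last by apply/funext.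
    exact: L1_cst.
  have mf : measurable_fun setT (EFin \o a n.+1) by exact/measurable_EFinP.
  have mp := measurable_funepos mf; have mn := measurable_funeneg mf.
  have pos_lt : (\int[P]_w (EFin \o a n.+1)^\+ w < +oo)%E.
    have [mS S_lt] := integrableP _ _ _ (iS n.+1); apply: le_lt_trans S_lt.
    apply: ae_ge0_le_integral => //; first exact: measurableT_comp.
    apply: filterS asub_all => w sw _ /=.
    rewrite funeposE/= ge_max !lee_fin normr_ge0 andbT.
    exact: le_trans (subadditive_birkhoff n.+1 (a0 w) sw) (ler_norm _).
  have pos_ge0 : (0 <= \int[P]_w (EFin \o a n.+1)^\+ w)%E by exact: integral_ge0.
  have neg_ge0 : (0 <= \int[P]_w (EFin \o a n.+1)^\- w)%E by exact: integral_ge0.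
  have neg_lt : (\int[P]_w (EFin \o a n.+1)^\- w < +oo)%E.
    rewrite ltey; apply/eqP => negy; have := A_le n.+1 isT.
    have posf : (\int[P]_w (EFin \o a n.+1)^\+ w)%E \is a fin_num.
      by rewrite ge0_fin_numE.
    rewrite integralE negy -(fineK posf) /=.
    by rewrite gt0_muleNy// lte_fin invr_gt0.
  have ip : P.-integrable setT (EFin \o a n.+1)^\+%E.
    by apply/integrableP; split => //; under eq_integral do rewrite gee0_abs//.
  have in_ : P.-integrable setT (EFin \o a n.+1)^\-%E.
    by apply/integrableP; split => //; under eq_integral do rewrite gee0_abs//.
  rewrite /L1 [X in P.-integrable _ X](funeposneg (EFin \o a n.+1)).
  exact: integrableB.
have intE n : (\int[P]_w (a n w)%:E)%E = (esp P (a n))%:E.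
  by rewrite /esp /Rintegral fineK//; apply: integrable_fin_num => //; exact: ia.
have A_le_esp n : A * n%:R <= esp P (a n).
  have [->|n0] := posnP n.
    rewrite mulr0 (_ : a 0%N = fun=> 0) ?esp_cst//; exact/funext.
  have := A_le n n0; rewrite intE -EFinM lee_fin ler_pdivlMl ?ltr0n//.
  by rewrite mulrC.
have A_inf (e : R) : 0 < e -> exists2 n, (0 < n)%N & esp P (a n) <= (A + e) * n%:R.
  move=> e0; have : (asymptotic_average P a < (A + e)%:E)%E.
    by rewrite -(fineK Afin) lte_fin ltrDl.
  move=> /ereal_inf_lt[_ [n /= n0 <-]]; rewrite intE -EFinM lte_fin => h.
  by exists n => //; move: h; rewrite ltr_pdivrMl ?ltr0n// mulrC => /ltW.
(* The facts [b_ge0] and [b_inf] below say together that the normalised average is 0. *)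
pose b n w := a n w - A * n%:R.
have ib n : L1 P (b n) by apply: L1B => //; exact: L1_cst.
have Eb n : esp P (b n) = esp P (a n) - A * n%:R.
  by rewrite espB ?esp_cst//; exact: L1_cst.
have b0 w : b 0%N w = 0 by rewrite /b a0 mulr0 subr0.
have bsub : {ae P, forall w, subadditive_at T b w}.
  apply: filterS asub_all => w sw n m i; have := sw n m i.
  rewrite /b natrD; lra.
have b_ge0 n : 0 <= esp P (b n) by rewrite Eb subr_ge0.
have b_inf (e : R) : 0 < e -> exists2 m, (0 < m)%N & esp P (b m) <= e * m%:R.
  move=> /A_inf[n n0 hn]; exists n => //; rewrite Eb; lra.
apply: (filterS3 _ _ bsub (subadditive_sublinear erg ib bsub b_inf)
  (ae_infinitely_many_good erg ib b0 bsub b_ge0 b_inf)).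
move=> w sw up [dl [dl0 dlcvg good]].
have /choice[ni hni] : forall M, exists n, (M <= n)%N /\ forall l, (0 < l <= n)%N ->
    b (n - l)%N (iter l T w) <= b n w + dl l * l%:R.
  by move=> M; have [n Mn hn] := good M; exists n.
(* [dl] controls the difference from below, and [up_] controls it from above through subadditivity
   at l. Their sum serves both sides and is positive because [dl] is. *)
pose up_ l := l%:R^-1 * Num.max 0 (b l w).
have up_cvg : up_ @ \oo --> 0 by exact: cvg_sublinear.
have up0 l : 0 <= up_ l by rewrite mulr_ge0 ?invr_ge0// le_max lexx.
exists ni, (fun l => dl l + up_ l); split; last split; last split.
- move=> M; exists M => // i /= Mi; exact: leq_trans Mi (hni i).1.
- by move=> l; exact: ltr_wpDr.
- by rewrite -[X in _ --> X]addr0; exact: cvgD.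
move=> i l; have [_ low] := hni i; set n := ni i in low * => ln.
have [->|l0] := posnP l; first by rewrite mul0r mulr0 subn0 subrr subr0 normr0.
have lR : 0 < l%:R :> R by rewrite ltr0n.
have := low l; rewrite l0 ln => /(_ isT) {}low.
have := sw l (n - l)%N 0%N; rewrite subnKC// addn0/= => high.
have bl : b l w <= l%:R * up_ l.
  by rewrite /up_ mulrA divff ?gt_eqF// mul1r le_max lexx orbT.
have -> : a n w - a (n - l)%N (iter l T w) - A * l%:R =
    b n w - b (n - l)%N (iter l T w).
  by rewrite /b natrB//; ring.
have := dl0 l; have := up0 l => u0 d0.
rewrite ler_norml; apply/andP; split; nra.
Qed.
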